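(* Let $G$ be a non-trivial connected graph on $n$ vertices, with $e(G)$ edges and diameter $\mathrm{diam}(G)$. (a) $\mathrm{diam}(G)\le rc(G)\le rc^\ell(G)\le n-1$, and $\mathrm{diam}(G)\le rc(G)\le src(G)\le src^\ell(G)\le e(G)$. (b) If $G$ has $p$ bridges, then $rc(G)\ge p$. (c) If $v$ is a cut-vertex of $G$ such that $G-v$ has $q\ge 2$ components, then $src(G)\ge q$. (d) If $n\ge 3$ and $w$ is a pendent vertex (vertex of degree $1$) of $G$, then $rc(G)\ge rc(G-w)$ and $src(G)\ge src(G-w)$. (e) The following are equivalent: (i) $G$ is a complete graph; (ii) $\mathrm{diam}(G)=1$; (iii) $rc(G)=1$; (iv) $src(G)=1$; (v) $rc^\ell(G)=1$; (vi) $src^\ell(G)=1$. (f) $rc(G)=2$ if and only if $src(G)=2$. Moreover, $src^\ell(G)=2$ implies $rc^\ell(G)=2$, which in turn implies both $rc(G)=2$ and $src(G)=2$. (g) The following are equivalent: (i) $G$ is a tree; (ii) $rc(G)=e(G)$; (iii) $src(G)=e(G)$; (iv) $rc^\ell(G)=e(G)$; (v) $src^\ell(G)=e(G)$.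
   Context: All graphs are finite, simple and undirected. An edge-colouring of a graph need not be proper. An edge-coloured path is rainbow if all its edges have distinct colours. A geodesic between two vertices is a path between them of shortest possible length. An edge-colouring of a connected graph $G$ is rainbow connected (resp. strongly rainbow connected) if any two vertices are joined by a rainbow path (resp. a rainbow geodesic). $rc(G)$ (resp. $src(G)$) is the minimum number of colours in a rainbow connected (resp. strongly rainbow connected) edge-colouring of $G$. An $r$-edge-list assignment of $G$ is a function $L$ assigning to each edge $e$ a set $L(e)\subset\mathbb N$ with $|L(e)|\ge r$; an $L$-edge-colouring is an edge-colouring $c$ with $c(e)\in L(e)$ for all edges $e$. The list rainbow connection number $rc^\ell(G)$ (resp. list strong rainbow connection number $src^\ell(G)$) is the minimum integer $r$ such that for every $r$-edge-list assignment $L$ of $G$ there is an $L$-edge-colouring of $G$ that is rainbow connected (resp. strongly rainbow connected). *)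

(* Defs.v *)
From mathcomp Require Import all_boot.
From mathcomp Require Import boolp classical_sets functions cardinality.

Set Implicit Arguments.
Unset Strict Implicit.
Unset Printing Implicit Defensive.

(* The value is 0 if no natural number satisfies P; the minima below that are
   taken over a connected graph are all attained. *)
Definition nat_min (P : nat -> Prop) : nat :=
  if pselect (exists n, `[<P n>]) is left exP then ex_minn exP else 0.

Lemma nat_minP (P : nat -> Prop) : (exists n, P n) ->
  P (nat_min P) /\ (forall m, P m -> nat_min P <= m).
Proof.
move=> [n Pn]; rewrite /nat_min; case: pselect => [exP | []]; last first.
  by exists n; apply/asboolP.
case: ex_minnP => m /asboolP Pm min_m; split=> // k Pk.
by apply: min_m; apply/asboolP.
Qed.

Record sgraph := SGraph {
  vertex :> finType;
  adj : rel vertex;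
  adj_sym : symmetric adj;
  adj_irrefl : irreflexive adj
}.

Definition edges (G : sgraph) : {set {set G}} :=
  [set [set p.1; p.2] | p : G * G & adj p.1 p.2].

Definition connected (G : sgraph) : Prop :=
  forall x y : G, connect (@adj G) x y.

Definition components (G : sgraph) : nat := n_comp (@adj G) predT.

Definition complete (G : sgraph) : Prop :=
  forall x y : G, x != y -> adj x y.

Definition tree (G : sgraph) : Prop :=
  connected G /\
  (forall s : seq G, 2 < size s -> ~ ucycle (@adj G) s).

Definition degree (G : sgraph) (v : G) : nat := #|[set u | adj v u]|.

Definition pendent (G : sgraph) (v : G) : Prop := degree v = 1.

Lemma del_vertex_sym (G : sgraph) (v : G) :
  symmetric (fun x y : {u : G | u != v} => adj (val x) (val y)).
Proof. by move=> x y; rewrite adj_sym. Qed.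

Lemma del_vertex_irrefl (G : sgraph) (v : G) :
  irreflexive (fun x y : {u : G | u != v} => adj (val x) (val y)).
Proof. by move=> x; rewrite adj_irrefl. Qed.

Definition del_vertex (G : sgraph) (v : G) : sgraph :=
  SGraph (@del_vertex_sym G v) (@del_vertex_irrefl G v).

Lemma del_edge_sym (G : sgraph) (e : {set G}) :
  symmetric (fun x y : G => adj x y && ([set x; y] != e)).
Proof. by move=> x y; rewrite adj_sym finset.setUC. Qed.

Lemma del_edge_irrefl (G : sgraph) (e : {set G}) :
  irreflexive (fun x y : G => adj x y && ([set x; y] != e)).
Proof. by move=> x; rewrite adj_irrefl. Qed.

Definition del_edge (G : sgraph) (e : {set G}) : sgraph :=
  SGraph (@del_edge_sym G e) (@del_edge_irrefl G e).

Definition bridges (G : sgraph) : {set {set G}} :=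
  [set e in edges G | components G < components (del_edge e)].

Definition cut_vertex (G : sgraph) (v : G) : Prop :=
  components G < components (del_vertex v).

(* The path with vertex sequence x :: p; its length is size p. *)
Definition is_path (G : sgraph) (x y : G) (p : seq G) : Prop :=
  [/\ path (@adj G) x p, last x p = y & uniq (x :: p)].

Definition geodesic (G : sgraph) (x y : G) (p : seq G) : Prop :=
  is_path x y p /\ (forall q : seq G, is_path x y q -> size p <= size q).

Definition dist (G : sgraph) (x y : G) : nat :=
  nat_min (fun k => exists2 p : seq G, is_path x y p & size p = k).

Definition diam (G : sgraph) : nat := \max_(x : G) \max_(y : G) dist x y.

(* Values outside [edges G] are never used. *)
Definition colouring (G : sgraph) : Type := {set G} -> nat.

Definition num_colours (G : sgraph) (c : colouring G) : nat :=
  size (undup [seq c e | e in edges G]).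

Definition rainbow (G : sgraph) (c : colouring G) (x : G) (p : seq G) : Prop :=
  uniq (pairmap (fun u v => c [set u; v]) x p).

Definition rainbow_connected (G : sgraph) (c : colouring G) : Prop :=
  forall x y : G, exists2 p : seq G, is_path x y p & rainbow c x p.

Definition strongly_rainbow_connected (G : sgraph) (c : colouring G) : Prop :=
  forall x y : G, exists2 p : seq G, geodesic x y p & rainbow c x p.

Definition rc (G : sgraph) : nat :=
  nat_min (fun k => exists2 c : colouring G,
    rainbow_connected c & num_colours c = k).

Definition src (G : sgraph) : nat :=
  nat_min (fun k => exists2 c : colouring G,
    strongly_rainbow_connected c & num_colours c = k).

Definition edge_list_assignment (G : sgraph) (r : nat)
    (L : {set G} -> set nat) : Prop :=
  forall e, e \in edges G -> (`I_r #<= L e)%card.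

Definition list_colouring (G : sgraph) (L : {set G} -> set nat)
    (c : colouring G) : Prop :=
  forall e, e \in edges G -> L e (c e).

Definition rcl (G : sgraph) : nat :=
  nat_min (fun r => forall L : {set G} -> set nat, edge_list_assignment r L ->
    exists2 c : colouring G, list_colouring L c & rainbow_connected c).

Definition srcl (G : sgraph) : nat :=
  nat_min (fun r => forall L : {set G} -> set nat, edge_list_assignment r L ->
    exists2 c : colouring G,
      list_colouring L c & strongly_rainbow_connected c).

(* Main.v *)
Require Import Defs.
From mathcomp Require Import boolp classical_sets functions cardinality.
From mathcomp Require Import all_boot zify.

Set Implicit Arguments.
Unset Strict Implicit.
Unset Printing Implicit Defensive.

(** The chains of inequalities come from two facts: a rainbow path is at most
    as long as the number of colours, and [r] edges with lists of size [r] can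
    be coloured injectively by a greedy choice.  Applied to a spanning tree the
    latter bounds [rcl] by [n - 1], applied to all edges it bounds [srcl] by
    [e(G)].  For (b), any two bridges separate a common pair of vertices, so
    their colours differ.

    The substantial part of (g) is that [srcl] drops below [e(G)] as soon as
    some edge [ab] is not a bridge.  Two edges of a geodesic are positioned so
    that both ends of the second are strictly closer to the same end of the
    first.  A path from [a] to [b] avoiding [ab] leaves the set of vertices
    closer to [a] than to [b] through some edge [cd]; hence no geodesic contains
    both [ab] and [cd], and these two edges may share a colour. *)

(** * Pairs, exits from a set, and distinct representatives *)

Lemma set2_eq (T : finType) (a b u v : T) :
  [set a; b] = [set u; v] -> (a = u /\ b = v) \/ (a = v /\ b = u).
Proof.
move=> E; have := set21 a b; have := set22 a b; rewrite E !inE.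
have := set21 u v; have := set22 u v; rewrite -E !inE.
by case/orP=> /eqP-> /orP[]/eqP-> /orP[]/eqP ? /orP[]/eqP ?; auto.
Qed.

(** The pair found is the first step of the walk that leaves [P]. *)
Lemma path_exit (T : Type) (e : rel T) (P : pred T) (x : T) (p : seq T) :
  path e x p -> P x -> ~~ P (last x p) ->
  exists u v, [/\ e u v, P u & ~~ P v].
Proof.
elim: p x => [|y p IH] x /=; first by move=> _ ->.
case/andP=> exy pyp Px; case: (boolP (P y)) => [Py|nPy _]; first exact: IH.
by exists x, y.
Qed.

(** Pigeonhole: an injection of [I_r] into [A] yields [r] distinct values, too many to fit into
    [s]. *)
Lemma card_le_avoid (r : nat) (A : set nat) (s : seq nat) :
  (`I_r #<= A)%card -> size s < r -> exists2 k, A k & k \notin s.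
Proof.
case/pcard_leP=> f lt_s_r.
have inI i : i < r -> i \in (`I_r : set nat) by move=> lt_i; apply: mem_set.
case: (boolP (all (mem s) [seq f i | i <- iota 0 r])) => [/allP sub_s|].
  have uniq_f : uniq [seq f i | i <- iota 0 r].
    rewrite map_inj_in_uniq ?iota_uniq // => i j.
    by rewrite !mem_iota => /inI Ii /inI Ij; apply: inj.
  by have := uniq_leq_size uniq_f sub_s; rewrite size_map size_iota leqNgt lt_s_r.
case/allPn=> k /mapP[i]; rewrite mem_iota => /= lt_i -> nsfi.
by exists (f i) => //; apply: (funS (s := f)).
Qed.

(** Greedy choice: when [x] gets its value, fewer than [r] values are already taken, so its list
    still offers a new one. *)
Lemma distinct_representatives (T : eqType) (L : T -> set nat) (r : nat)
    (s : seq T) :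
  uniq s -> size s <= r -> {in s, forall e, (`I_r #<= L e)%card} ->
  exists2 c : T -> nat, {in s, forall e, L e (c e)} & {in s &, injective c}.
Proof.
elim: s => [|x s IH] /=; first by exists (fun=> 0).
case/andP=> nsx Us lt_s_r Lr.
have [|c cL cI] := IH Us (ltnW lt_s_r).
  by move=> e se; apply: Lr; rewrite inE se orbT.
have [||k Lk nk] := @card_le_avoid r (L x) (map c s); rewrite ?size_map //.
  exact/Lr/mem_head.
exists (fun e => if e == x then k else c e).
  by move=> e; rewrite inE; case: eqP => [->|_] //= /cL.
have ks e : e \in s -> c e <> k.
  by move=> se ce; case/negP: nk; rewrite -ce; apply: map_f.
move=> e f; rewrite !inE; case: eqP => [->|_] /=; case: eqP => [->|_] //=.
- by move=> _ /ks ns /esym.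
- by move=> /ks.
- exact: cI.
Qed.

(** * Edges, list colourings and rainbow paths *)

Lemma edgesP (G : sgraph) (e : {set G}) :
  reflect (exists u v, adj u v /\ e = [set u; v]) (e \in edges G).
Proof.
apply: (iffP imsetP) => [[[u v] /= ] | [u [v [auv ->]]]].
  by rewrite inE => auv ->; exists u, v.
by exists (u, v); rewrite ?inE.
Qed.

Lemma adj_edge (G : sgraph) (u v : G) : adj u v -> [set u; v] \in edges G.
Proof. by move=> auv; apply/edgesP; exists u, v. Qed.

Lemma adj_connect_sym (G : sgraph) : connect_sym (@adj G).
Proof. exact/sym_connect_sym/adj_sym. Qed.

(** Edges of [T] receive distinct representatives, all others any element of their list. Varying [T]
    serves several bounds: a spanning set, all edges, all edges but one, or no edge. *)
Lemma list_colouring_inj (G : sgraph) (r : nat) (L : {set G} -> set nat)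
    (T : {set {set G}}) :
  edge_list_assignment r L -> 0 < r -> T \subset edges G -> #|T| <= r ->
  exists2 c : colouring G, list_colouring L c & {in T &, injective c}.
Proof.
move=> rL r_gt0 /subsetP TE leTr.
have [||e|c cL cI] := @distinct_representatives _ L r (enum T).
- exact: enum_uniq.
- by rewrite -cardE.
- by rewrite mem_enum => /TE /rL.
have /choice[d dL] : forall e, exists k, e \in edges G -> L e k.
  move=> e; case: (boolP (e \in edges G)) => [/rL eL|_]; last by exists 0.
  by have [k Lk _] := card_le_avoid (s := [::]) eL r_gt0; exists k.
exists (fun e => if e \in T then c e else d e).
  by move=> e eE; case: ifP => [eT|_]; [apply: cL; rewrite mem_enum | apply: dL].
by move=> e f eT fT; rewrite eT fT; apply: cI; rewrite mem_enum.
Qed.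

Definition path_edges (G : sgraph) (x : G) (p : seq G) : seq {set G} :=
  pairmap (fun u v => [set u; v]) x p.

Lemma rainbowE (G : sgraph) (c : colouring G) (x : G) (p : seq G) :
  rainbow c x p <-> uniq [seq c e | e <- path_edges x p].
Proof.
rewrite /rainbow; suff -> : pairmap (fun u v => c [set u; v]) x p =
  [seq c e | e <- path_edges x p] by [].
by elim: p x => //= y p IH x; rewrite IH.
Qed.

Lemma path_edges_sub (G : sgraph) (x : G) (p : seq G) :
  path (@adj G) x p -> {subset path_edges x p <= edges G}.
Proof.
elim: p x => //= y p IH x /andP[axy /IH pE] e; rewrite inE.
by case/orP=> [/eqP->|/pE//]; apply: adj_edge.
Qed.

Lemma path_edges_vertex (G : sgraph) (x z : G) (p : seq G) (e : {set G}) :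
  e \in path_edges x p -> z \in e -> z \in x :: p.
Proof.
elim: p x => //= y p IH x; rewrite in_cons => /orP[/eqP->|ep ze].
  by rewrite !inE => /orP[]->; rewrite ?orbT.
by rewrite inE IH ?orbT.
Qed.

Lemma uniq_path_edges (G : sgraph) (x : G) (p : seq G) :
  uniq (x :: p) -> uniq (path_edges x p).
Proof.
elim: p x => //= y p IH x /andP[nx Uyp]; rewrite IH // andbT.
by apply: contra nx => /path_edges_vertex; apply; apply: set21.
Qed.

Lemma path_edges_nth (G : sgraph) (x : G) (p : seq G) (e : {set G}) :
  e \in path_edges x p ->
  exists2 i, i < size p & e = [set nth x (x :: p) i; nth x (x :: p) i.+1].
Proof.
case/(nthP set0)=> i; rewrite size_pairmap => lt_i <-.
by exists i => //; rewrite (nth_pairmap x).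
Qed.

Lemma rainbow_inj_in (G : sgraph) (c : colouring G) (x y : G) (p : seq G) :
  is_path x y p -> {in path_edges x p &, injective c} -> rainbow c x p.
Proof.
by case=> _ _ Up cI; apply/rainbowE; rewrite map_inj_in_uniq ?uniq_path_edges.
Qed.

Lemma rainbow_neq (G : sgraph) (c : colouring G) (x : G) (p : seq G)
    (e f : {set G}) :
  rainbow c x p -> e \in path_edges x p -> f \in path_edges x p ->
  e != f -> c e != c f.
Proof.
move/rainbowE/(uniqP 0)=> cI ep fp; apply: contra_neq => cef.
rewrite -(nth_index set0 ep) -(nth_index set0 fp); congr nth.
by apply: cI; rewrite ?inE ?size_map ?index_mem // !(nth_map set0)
  ?index_mem // !nth_index.
Qed.

Lemma rainbow_size (G : sgraph) (c : colouring G) (x y : G) (p : seq G) :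
  is_path x y p -> rainbow c x p -> size p <= num_colours c.
Proof.
case=> pth _ _ /rainbowE Uc.
have -> : size p = size [seq c e | e <- path_edges x p].
  by rewrite size_map size_pairmap.
apply: uniq_leq_size => // k /mapP[e /(path_edges_sub pth) eE ->].
by rewrite mem_undup; apply: image_f.
Qed.

(** The index type [T] is free so that one can count bridges, with [f] the identity, as well as
    components, with [f] picking an edge for each. *)
Lemma num_colours_ge (G : sgraph) (c : colouring G) (T : finType)
    (A : {pred T}) (f : T -> {set G}) :
  {in A, forall x, f x \in edges G} -> {in A &, injective (c \o f)} ->
  #|A| <= num_colours c.
Proof.
move=> fE cI; rewrite -(size_image (c \o f) A).
apply: uniq_leq_size; first by rewrite map_inj_in_uniq ?enum_uniq // => x y;
  rewrite !mem_enum; apply: cI.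
by move=> k /mapP[x]; rewrite mem_enum => /fE xE ->; rewrite mem_undup; apply: image_f.
Qed.

Lemma num_colours_le (G : sgraph) (c : colouring G) (r : nat) :
  {in edges G, forall e, c e < r} -> num_colours c <= r.
Proof.
move=> cr; rewrite -(size_iota 0 r); apply: uniq_leq_size; first exact: undup_uniq.
by move=> k; rewrite mem_undup => /imageP[e /cr lt_e ->]; rewrite mem_iota.
Qed.

(** * Distances and geodesics *)

(** Lets arbitrary walks bound [dist] from above, although [is_path] demands distinct vertices. *)
Lemma path_shorten (G : sgraph) (x : G) (p : seq G) :
  path (@adj G) x p -> exists2 q, is_path x (last x p) q & size q <= size p.
Proof.
case/shortenP=> q pq Uq sub; exists q => //.
by apply: uniq_leq_size => //; case/andP: Uq.
Qed.

Lemma dist_attained (G : sgraph) (x y : G) : connected G ->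
  exists2 p, geodesic x y p & size p = dist x y.
Proof.
move=> /(_ x y) /connectP[p /path_shorten[q qP _] yE].
have [|[s sP sd] dmin] :=
  @nat_minP (fun k => exists2 p : seq G, is_path x y p & size p = k).
  by exists (size q), q => //; rewrite yE.
exists s; last exact: sd.
by split=> // t tP; rewrite sd; apply: dmin; exists t.
Qed.

Lemma geodesic_size (G : sgraph) (x y : G) (p : seq G) : connected G ->
  geodesic x y p -> size p = dist x y.
Proof.
move=> cG [pP pmin]; have [q [qP qmin] <-] := dist_attained x y cG.
by apply/eqP; rewrite eqn_leq pmin ?qmin.
Qed.

Lemma dist_le_path (G : sgraph) (x : G) (p : seq G) : connected G ->
  path (@adj G) x p -> dist x (last x p) <= size p.
Proof.
move=> cG /path_shorten[q qP /(leq_trans _)]; apply.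
by have [s [_ smin] <-] := dist_attained x (last x p) cG; apply: smin.
Qed.

Lemma dist_triangle (G : sgraph) (y x z : G) : connected G ->
  dist x z <= dist x y + dist y z.
Proof.
move=> cG; have [p [[pp <- _] _] <-] := dist_attained x y cG.
have [q [[pq <- _] _] <-] := dist_attained (last x p) z cG.
by rewrite -last_cat -size_cat; apply: dist_le_path; rewrite // cat_path pp.
Qed.

Lemma dist_sym (G : sgraph) (x y : G) : connected G -> dist x y = dist y x.
Proof.
move=> cG; suff le (u v : G) : dist u v <= dist v u by apply/eqP; rewrite eqn_leq !le.
have [p [[pp <- _] _] <-] := dist_attained v u cG.
(* The reversed walk from [last v p] is [rev (belast v p)], and it ends in [v]. *)
have -> : dist (last v p) v = dist (last v p) (last (last v p) (rev (belast v p))).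
  by case: p {pp} => //= w p; rewrite rev_cons last_rcons.
rewrite -(size_belast v p) -size_rev; apply: dist_le_path => //.
by rewrite rev_path (eq_path (e' := @adj G)) // => a b; rewrite adj_sym.
Qed.

Lemma dist_xx (G : sgraph) (x : G) : connected G -> dist x x = 0.
Proof. by move=> cG; apply/eqP; rewrite -leqn0 (@dist_le_path _ x [::]). Qed.

Lemma dist_adj (G : sgraph) (x y : G) : connected G -> adj x y -> dist x y <= 1.
Proof. by move=> cG axy; apply: (@dist_le_path _ x [:: y]); rewrite //= axy. Qed.

Lemma dist_eq0 (G : sgraph) (x y : G) : connected G -> dist x y = 0 -> x = y.
Proof.
by move=> cG; have [[|z p] [[_ /= <- _] _] <-] := dist_attained x y cG.
Qed.

Lemma dist_le1 (G : sgraph) (x y : G) : connected G ->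
  dist x y <= 1 -> x != y -> adj x y.
Proof.
move=> cG; have [[|z [|? p]] [[/= ap <- _] _] <- //] := dist_attained x y cG.
  by rewrite eqxx.
by rewrite andbT in ap.
Qed.

Lemma dist_le_diam (G : sgraph) (x y : G) : dist x y <= diam G.
Proof.
apply: leq_trans (leq_bigmax (F := fun x => \max_y dist x y) x).
exact: (leq_bigmax (F := fun y => dist x y)).
Qed.

(** Walking along [p] gives the upper bounds. The segments before [i], from [i] to [j] and after [j]
    must together cover the full distance [size p], so by the triangle inequality none of them can
    be shortened. *)
Lemma dist_geodesic_nth (G : sgraph) (x y : G) (p : seq G) (i j : nat) :
  connected G -> geodesic x y p -> i <= j -> j <= size p ->
  dist (nth x (x :: p) i) (nth x (x :: p) j) = j - i.
Proof.
move=> cG gp; set s := nth x (x :: p).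
have [[pp lp _] _] := gp.
have le_dist a b : a <= b -> b <= size p -> dist (s a) (s b) <= b - a.
  elim: b => [|b IH]; first by rewrite leqn0 => /eqP-> _; rewrite dist_xx.
  rewrite leq_eqVlt => /orP[/eqP->|]; first by rewrite dist_xx.
  rewrite ltnS => le_ab lt_b; have := IH le_ab (ltnW lt_b).
  have := dist_triangle (s b) (s a) (s b.+1) cG.
  have : dist (s b) (s b.+1) <= 1 by apply/dist_adj/(pathP x pp).
  lia.
move=> le_ij le_j; apply/eqP; rewrite eqn_leq le_dist //=.
have sy : s (size p) = y by rewrite /s -last_nth.
have := geodesic_size cG gp; rewrite -[in dist _ _]sy -[x in dist x]/(s 0).
have := le_dist 0 i (leq0n i) (leq_trans le_ij le_j).
have := le_dist j (size p) le_j (leqnn _).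
have := dist_triangle (s i) (s 0) (s (size p)) cG.
have := dist_triangle (s j) (s i) (s (size p)) cG.
lia.
Qed.
(** Distances between the four ends are differences of positions on [p]. One edge lies wholly before
    the other, up to a shared vertex, so the comparison comes out the same for [c] and for [d]. *)
Lemma geodesic_edges_same_side (G : sgraph) (x y a b c d : G) (p : seq G) :
  connected G -> geodesic x y p ->
  [set a; b] \in path_edges x p -> [set c; d] \in path_edges x p ->
  [set a; b] != [set c; d] ->
  dist a c < dist b c -> dist a d < dist b d.
Proof.
move=> cG gp /path_edges_nth[i lt_i abE] /path_edges_nth[j lt_j cdE] neq.
have {neq} ij : i != j.
  by apply: contraNneq neq => ij; rewrite abE cdE ij.
have dE m n := @dist_geodesic_nth _ _ _ _ m n cG gp.
have [lt_ij|le_ji] := ltnP i j.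
  have d1 := dE i j; have d2 := dE i j.+1.
  have d3 := dE i.+1 j; have d4 := dE i.+1 j.+1.
  by case: (set2_eq abE) => -[-> ->]; case: (set2_eq cdE) => -[-> ->]; lia.
have dE' m n : n <= m -> m <= size p ->
    dist (nth x (x :: p) m) (nth x (x :: p) n) = m - n.
  by move=> le_nm le_m; rewrite dist_sym // dE.
have d1 := dE' i j; have d2 := dE' i j.+1.
have d3 := dE' i.+1 j; have d4 := dE' i.+1 j.+1.
by case: (set2_eq abE) => -[-> ->]; case: (set2_eq cdE) => -[-> ->]; lia.
Qed.

(** * Spanning edge sets *)

(** Breadth-first tree: every vertex other than a root [r0] contributes one edge, to a neighbour
    strictly nearer to [r0]. Following these edges reaches [r0] from everywhere. *)
Lemma spanning_edges (G : sgraph) : connected G ->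
  exists T : {set {set G}}, [/\ T \subset edges G, #|T| <= #|G| - 1 &
    forall x y : G, exists2 p, is_path x y p & {subset path_edges x p <= T}].
Proof.
move=> cG; case: (pickP G) => [r0 _|G0]; last first.
  exists set0; split; rewrite ?sub0set ?cards0 // => x.
  by have := G0 x.
have /fin_all_exists[f fP] : forall x : G, exists y,
    x != r0 -> adj x y /\ dist y r0 < dist x r0.
  move=> x; have [[|y p] [[/= pp lp _] _] dE] := dist_attained x r0 cG.
    (* The root has no nearer neighbour; [x] itself fills in as its value. *)
    by exists x; rewrite lp eqxx.
  case/andP: pp => axy pp; exists y; split=> //; rewrite -dE -lp.
  exact: dist_le_path.
pose T := [set [set x; f x] | x in [set~ r0]].
pose t := [rel u v : G | adj u v && ([set u; v] \in T)].
have tsym : symmetric t by move=> u v; rewrite /= adj_sym setUC.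
have root_t x : connect t x r0.
  have [n] := ubnP (dist x r0); elim: n x => // n IH x; rewrite ltnS => le_n.
  have [->//|xr0] := eqVneq x r0.
  have [axf lt_f] := fP x xr0.
  apply: connect_trans (IH (f x) (leq_trans lt_f le_n)).
  by apply: connect1; rewrite /= axf; apply: imset_f; rewrite !inE.
exists T; split.
- by apply/subsetP=> e /imsetP[x]; rewrite !inE => /fP[axf _] ->; apply: adj_edge.
- by rewrite subn1 -(cardsC1 r0) leq_imset_card.
move=> x y.
have /connectP[p pp ->] : connect t x y.
  by apply: connect_trans (root_t x) _; rewrite (sym_connect_sym tsym).
case/shortenP: pp => q pq Uq _.
exists q; first by split=> //; apply: sub_path pq => u v /andP[].
elim: q x pq {Uq} => //= z q IH x /andP[/andP[_ xzT] /IH qT] e.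
by rewrite inE => /orP[/eqP->|/qT].
Qed.

(** * The four minima are attained *)

Lemma strongly_rainbow_connectedW (G : sgraph) (c : colouring G) :
  strongly_rainbow_connected c -> rainbow_connected c.
Proof. by move=> src_c x y; have [p [pP _] rp] := src_c x y; exists p. Qed.

Lemma src_inj_in (G : sgraph) (c : colouring G) : connected G ->
  {in edges G &, injective c} -> strongly_rainbow_connected c.
Proof.
move=> cG cI x y; have [p gp _] := dist_attained x y cG; exists p => //.
have [pP _] := gp; have [pp _ _] := pP; apply: (rainbow_inj_in pP).
by move=> e f /(path_edges_sub pp) eE /(path_edges_sub pp); apply: cI.
Qed.

(** Provides the colouring that makes the sets minimised in [rc] and [src] non-empty. *)
Lemma enum_rank_strongly_rainbow_connected (G : sgraph) : connected G ->
  strongly_rainbow_connected (fun e : {set G} => enum_rank e : nat).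
Proof.
by move=> cG; apply: src_inj_in => // e f _ _ /val_inj; apply: enum_rank_inj.
Qed.

Lemma rc_le (G : sgraph) (c : colouring G) :
  rainbow_connected c -> rc G <= num_colours c.
Proof.
move=> rc_c; have [|_] := @nat_minP (fun k => exists2 c : colouring G,
  rainbow_connected c & num_colours c = k); first by exists (num_colours c), c.
by apply; exists c.
Qed.

Lemma src_le (G : sgraph) (c : colouring G) :
  strongly_rainbow_connected c -> src G <= num_colours c.
Proof.
move=> rc_c; have [|_] := @nat_minP (fun k => exists2 c : colouring G,
  strongly_rainbow_connected c & num_colours c = k);
  first by exists (num_colours c), c.
by apply; exists c.
Qed.

Lemma rc_attained (G : sgraph) : connected G ->
  exists2 c : colouring G, rainbow_connected c & num_colours c = rc G.
Proof.
move=> /enum_rank_strongly_rainbow_connected/strongly_rainbow_connectedW cP.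
have [|//] := @nat_minP (fun k => exists2 c : colouring G,
  rainbow_connected c & num_colours c = k).
by eexists; eexists; first exact: cP.
Qed.

Lemma src_attained (G : sgraph) : connected G ->
  exists2 c : colouring G, strongly_rainbow_connected c & num_colours c = src G.
Proof.
move=> /enum_rank_strongly_rainbow_connected cP.
have [|//] := @nat_minP (fun k => exists2 c : colouring G,
  strongly_rainbow_connected c & num_colours c = k).
by eexists; eexists; first exact: cP.
Qed.

Lemma rcl_le (G : sgraph) (r : nat) :
  (forall L : {set G} -> set nat, edge_list_assignment r L ->
    exists2 c : colouring G, list_colouring L c & rainbow_connected c) ->
  rcl G <= r.
Proof.
by move=> rP; have [|_] := @nat_minP (fun r => forall L : {set G} -> set nat,
  edge_list_assignment r L -> exists2 c : colouring G,
    list_colouring L c & rainbow_connected c); [exists r | apply].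
Qed.

Lemma srcl_le (G : sgraph) (r : nat) :
  (forall L : {set G} -> set nat, edge_list_assignment r L ->
    exists2 c : colouring G,
      list_colouring L c & strongly_rainbow_connected c) ->
  srcl G <= r.
Proof.
by move=> rP; have [|_] := @nat_minP (fun r => forall L : {set G} -> set nat,
  edge_list_assignment r L -> exists2 c : colouring G,
    list_colouring L c & strongly_rainbow_connected c); [exists r | apply].
Qed.

(** Both makes the list minima attained and bounds [srcl] by the number of edges. *)
Lemma list_colouring_edges (G : sgraph) (L : {set G} -> set nat) :
  connected G -> 0 < #|edges G| -> edge_list_assignment #|edges G| L ->
  exists2 c : colouring G, list_colouring L c & strongly_rainbow_connected c.
Proof.
move=> cG E0 rL; have [c cL cI] := list_colouring_inj rL E0 (subxx _) (leqnn _).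
by exists c => //; apply: src_inj_in.
Qed.

Lemma rcl_attained (G : sgraph) : connected G -> 0 < #|edges G| ->
  forall L : {set G} -> set nat, edge_list_assignment (rcl G) L ->
    exists2 c : colouring G, list_colouring L c & rainbow_connected c.
Proof.
move=> cG E0; have [|//] := @nat_minP (fun r => forall L : {set G} -> set nat,
  edge_list_assignment r L -> exists2 c : colouring G,
    list_colouring L c & rainbow_connected c).
exists #|edges G| => L /(list_colouring_edges cG E0)[c cL].
by move=> /strongly_rainbow_connectedW; exists c.
Qed.

Lemma srcl_attained (G : sgraph) : connected G -> 0 < #|edges G| ->
  forall L : {set G} -> set nat, edge_list_assignment (srcl G) L ->
    exists2 c : colouring G,
      list_colouring L c & strongly_rainbow_connected c.
Proof.
move=> cG E0; have [|//] := @nat_minP (fun r => forall L : {set G} -> set nat,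
  edge_list_assignment r L -> exists2 c : colouring G,
    list_colouring L c & strongly_rainbow_connected c).
by exists #|edges G| => L; apply: list_colouring_edges.
Qed.

(** With all lists equal to [I_r], a list colouring is an ordinary colouring with at most [r]
    colours; this compares [rc] with [rcl] and [src] with [srcl]. *)
Lemma list_colouring_initial (G : sgraph) (r : nat) (c : colouring G) :
  list_colouring (fun=> `I_r) c -> num_colours c <= r.
Proof. by move=> cL; apply: num_colours_le => e /cL. Qed.

(** * The chains of inequalities *)

Lemma diam_le_rc (G : sgraph) : connected G -> diam G <= rc G.
Proof.
move=> cG; have [c cP <-] := rc_attained cG.
apply/bigmax_leqP=> x _; apply/bigmax_leqP=> y _.
have [p pP rp] := cP x y; apply: leq_trans (rainbow_size pP rp).
by case: pP => pp <- _; apply: dist_le_path.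
Qed.

Lemma rc_le_src (G : sgraph) : connected G -> rc G <= src G.
Proof.
move=> cG; have [c cP <-] := src_attained cG.
exact/rc_le/strongly_rainbow_connectedW.
Qed.

Lemma rc_le_rcl (G : sgraph) : connected G -> 0 < #|edges G| -> rc G <= rcl G.
Proof.
move=> cG E0; have [|c cL cP] := rcl_attained cG E0 (L := fun=> `I_(rcl G)).
  by move=> e _; apply: card_lexx.
exact: leq_trans (rc_le cP) (list_colouring_initial cL).
Qed.

Lemma src_le_srcl (G : sgraph) : connected G -> 0 < #|edges G| ->
  src G <= srcl G.
Proof.
move=> cG E0; have [|c cL cP] := srcl_attained cG E0 (L := fun=> `I_(srcl G)).
  by move=> e _; apply: card_lexx.
exact: leq_trans (src_le cP) (list_colouring_initial cL).
Qed.

Lemma rcl_le_srcl (G : sgraph) : connected G -> 0 < #|edges G| ->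
  rcl G <= srcl G.
Proof.
move=> cG E0; apply: rcl_le => L /(srcl_attained cG E0)[c cL].
by move=> /strongly_rainbow_connectedW; exists c.
Qed.

Lemma srcl_le_edges (G : sgraph) : connected G -> 0 < #|edges G| ->
  srcl G <= #|edges G|.
Proof. by move=> cG E0; apply: srcl_le => L; apply: list_colouring_edges. Qed.

Lemma rcl_le_order (G : sgraph) : connected G -> 1 < #|G| ->
  rcl G <= #|G| - 1.
Proof.
move=> cG G1; have [T [TE leT TP]] := spanning_edges cG.
apply: rcl_le => L rL.
have [|c cL cI] := list_colouring_inj rL _ TE leT; first by rewrite subn_gt0.
exists c => // x y; have [p pP pT] := TP x y; exists p => //.
by apply: rainbow_inj_in pP _ => e f /pT eT /pT; apply: cI.
Qed.

Lemma edges_gt0 (G : sgraph) : connected G -> 1 < #|G| -> 0 < #|edges G|.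
Proof.
move=> cG /card_gt1P[x [y [_ _ neq]]]; apply/card_gt0P.
have /connectP[[|z p] /= pp yE] := cG x y; first by rewrite yE eqxx in neq.
by exists [set x; z]; apply: adj_edge; case/andP: pp.
Qed.

(** * Components and bridges *)

Lemma components_gt1 (G : sgraph) (x y : G) :
  ~~ connect (@adj G) x y -> 1 < components G.
Proof.
move=> nxy; apply/card_gt1P; exists (root (@adj G) x), (root (@adj G) y).
split; rewrite ?inE ?(roots_root (@adj_connect_sym G)) //.
by apply: contraNneq nxy => /(rootP (@adj_connect_sym G)).
Qed.

Lemma components_le1 (G : sgraph) : connected G -> components G <= 1.
Proof.
move=> cG; apply/card_le1_eqP=> x y; rewrite !inE !andbT => /eqP<- /eqP<-.
exact/(rootP (@adj_connect_sym G)).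
Qed.

Lemma components_gt0 (G : sgraph) (x : G) : 0 < components G.
Proof.
apply/card_gt0P; exists (root (@adj G) x).
by rewrite !inE (roots_root (@adj_connect_sym G)).
Qed.

(** If [a] and [b] stay connected, each use of the deleted edge can be rerouted, so the graph stays
    connected and the number of components does not grow. *)
Lemma bridgeP (G : sgraph) (a b : G) : connected G -> adj a b ->
  reflect (~ connect (@adj (del_edge [set a; b])) a b)
          ([set a; b] \in bridges G).
Proof.
move=> cG aab; rewrite inE adj_edge //=; set H := del_edge _.
apply: (iffP idP) => [lt_comp cab|/negP nab]; last first.
  exact: leq_ltn_trans (components_le1 cG) (components_gt1 (G := H) nab).
have /components_le1 : connected H.
  move=> x y; move: (cG x y); apply: connect_sub => u v auv.
  have [/set2_eq[[-> ->]//|[-> ->]]|neq] := eqVneq [set u; v] [set a; b].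
    by rewrite (@adj_connect_sym H).
  by apply: connect1; rewrite /= auv.
by rewrite leqNgt (leq_ltn_trans (components_gt0 a) lt_comp).
Qed.

Lemma path_del_edge (G : sgraph) (x : G) (p : seq G) (e : {set G}) :
  path (@adj G) x p -> e \notin path_edges x p ->
  path (@adj (del_edge e)) x p.
Proof.
elim: p x => //= y p IH x /andP[axy pp]; rewrite inE negb_or => /andP[ne np].
by rewrite axy eq_sym ne IH.
Qed.

Lemma connect_del_edge (G : sgraph) (x y : G) (p : seq G) (e : {set G}) :
  is_path x y p -> ~~ connect (@adj (del_edge e)) x y ->
  e \in path_edges x p.
Proof.
case=> pp <- _; apply: contraR => /(path_del_edge pp) pe.
by apply/connectP; exists p.
Qed.

Lemma bridges_colours_neq (G : sgraph) (k : colouring G) (e f : {set G}) :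
  connected G -> rainbow_connected k -> e \in bridges G -> f \in bridges G ->
  e != f -> k e != k f.
Proof.
move=> cG kP eB fB nef.
have /edgesP[a [b [aab eE]]] : e \in edges G by case/setIdP: eB.
have /edgesP[c [d [acd fE]]] : f \in edges G by case/setIdP: fB.
have /(bridgeP cG aab) ne : [set a; b] \in bridges G by rewrite -eE.
have /(bridgeP cG acd) nf : [set c; d] \in bridges G by rewrite -fE.
rewrite -eE in ne; rewrite -fE in nf.
set Ce := connect (@adj (del_edge e)) in ne.
set Cf := connect (@adj (del_edge f)) in nf.
have Ce_sym : symmetric Ce := @adj_connect_sym (del_edge e).
have Cf_sym : symmetric Cf := @adj_connect_sym (del_edge f).
(* Being distinct from [e], the edge [f] survives the deletion of [e] and so lies on one side of it;
   likewise with the roles exchanged. *)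
have Ccd : Ce c d by apply: connect1; rewrite /= acd -fE eq_sym.
have Cab : Cf a b by apply: connect1; rewrite /= aab -eE.
(* Take [x] as the end of [e] facing away from [f], and [y] as the end of [f] facing away from [e].
   Both bridges then separate [x] from [y], so every path between them contains both. *)
have [x xab nxc] : exists2 x, x \in e & ~~ Ce x c.
  have [ac|] := boolP (Ce a c); last by exists a; rewrite // eE set21.
  exists b; first by rewrite eE set22.
  by apply/negP=> bc; apply: ne; apply: connect_trans ac _; rewrite -/Ce Ce_sym.
have [y ycd nya] : exists2 y, y \in f & ~~ Cf a y.
  have [ac|] := boolP (Cf a c); last by exists c; rewrite // fE set21.
  exists d; first by rewrite fE set22.
  by apply/negP=> ad; apply: nf; apply: connect_trans ad; rewrite -/Cf Cf_sym.
have nexy : ~~ Ce x y.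
  apply: contra nxc => xy; apply: connect_trans xy _.
  by move: ycd; rewrite fE !inE => /orP[]/eqP-> //; rewrite -/Ce Ce_sym.
have nfxy : ~~ Cf x y.
  apply: contra nya => xy; apply: connect_trans xy.
  by move: xab; rewrite eE !inE => /orP[]/eqP->.
have [p pP rp] := kP x y.
by apply: (rainbow_neq rp) => //; apply: (connect_del_edge pP).
Qed.

Lemma bridges_le_rc (G : sgraph) : connected G -> #|bridges G| <= rc G.
Proof.
move=> cG; have [c cP <-] := rc_attained cG.
apply: (@num_colours_ge _ _ _ _ id) => [e|e f eB fB /= cef].
  by case/setIdP.
by apply/eqP; apply: contraPT cef => /(bridges_colours_neq cG cP eB fB)/eqP.
Qed.

(** * Cut-vertices *)

(** Cut the walk just before its first visit to [v]. *)
Lemma path_reach_neighbour (G : sgraph) (v : G) (x : del_vertex v)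
    (p : seq G) :
  path (@adj G) (val x) p -> last (val x) p = v ->
  exists2 u : del_vertex v, adj v (val u) & connect (@adj (del_vertex v)) x u.
Proof.
elim: p x => [|y p IH] x /=; first by move=> _; have /eqP := valP x.
case/andP=> axy pp lp; have [yv|yv] := eqVneq y v.
  by exists x => //; rewrite adj_sym -[X in adj _ X]yv.
have [u vu cu] := IH (Sub y yv) pp lp; exists u => //.
by apply: connect_trans cu; apply: connect1.
Qed.

(** Choose in each component of [G - v] a neighbour of [v]. Two such neighbours in different
    components have [v] as their only common neighbour, so their unique geodesic runs through [v]
    and the two edges at [v] need different colours. *)
Lemma components_le_src (G : sgraph) (v : G) : connected G ->
  components (del_vertex v) <= src G.
Proof.
move=> cG; have [c cP <-] := src_attained cG; set H := del_vertex v.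
have /fin_all_exists[f fP] : forall x : H, exists u : H,
    adj v (val u) /\ connect (@adj H) x u.
  move=> x; have /connectP[p pp /esym lp] := cG (val x) v.
  by have [u] := path_reach_neighbour pp lp; exists u.
apply: (@num_colours_ge _ _ _ _ (fun x => [set v; val (f x)])) => [x _|x y].
  by apply/adj_edge; case: (fP x).
rewrite !inE !andbT => /eqP rx /eqP ry /= cxy; rewrite -rx -ry.
apply/(rootP (@adj_connect_sym H)); apply/idPn=> nxy.
have [[vfx xfx] [vfy yfy]] := (fP x, fP y).
have {nxy} nf : ~~ connect (@adj H) (f x) (f y).
  apply: contra nxy => cf; apply: connect_trans xfx (connect_trans cf _).
  by rewrite adj_connect_sym.
have [p [[pp lp Up] pmin] rp] := cP (val (f x)) (val (f y)).
have neq : val (f x) != val (f y).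
  by apply: contraNneq nf => /val_inj->.
have : size p <= 2.
  apply: (pmin [:: v; val (f y)]); split=> //=.
    by rewrite adj_sym vfx vfy.
  by rewrite !inE negb_or neq (valP (f x)) eq_sym (valP (f y)).
(* A geodesic with no edge, with one edge, or with a middle vertex other than [v] would join the two
   components inside [G - v]. *)
case: p pp lp Up rp {pmin} => [|z [|w [|//]]] /=.
- by move=> _ /eqP; rewrite (negPf neq).
- by rewrite andbT => + zE; rewrite zE => axz; case/negP: nf; apply: connect1.
case/and3P=> axz azw _ wE _ + _; rewrite {}wE {w} in azw *.
have [->|zv] := eqVneq z v; last first.
  case/negP: nf; apply: (@connect_trans _ _ (Sub z zv)); exact: connect1.
by rewrite /rainbow /= inE setUC cxy eqxx.
Qed.

(** * Pendent vertices *)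

(** An inner vertex of a path has a predecessor and a successor, which degree one would force to
    coincide. *)
Lemma pendent_notin_path (G : sgraph) (w x y : G) (p : seq G) :
  pendent w -> x != w -> y != w -> is_path x y p -> w \notin p.
Proof.
move=> dw xw yw [pp lp Up]; apply/negP=> /splitPr wp.
case: wp Up pp lp => p1 p2; rewrite -cat_cons cat_uniq => /and3P[_ /hasPn np _].
case: p2 np => [|z p2] np; rewrite cat_path last_cat /=.
  by move=> _ wy; rewrite wy eqxx in yw.
case/and4P=> _ a1 a2 _ _.
have /card_le1_eqP Nw : #|[set u | adj w u]| <= 1 by rewrite -/(degree w) dw.
have := np z; rewrite !inE eqxx orbT => /(_ isT)/negP; apply.
have -> : z = last x p1 by apply: Nw; rewrite inE // adj_sym.
by rewrite -in_cons mem_last.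
Qed.

Lemma is_path_del_vertex (G : sgraph) (w : G) (x y : del_vertex w)
    (q : seq (del_vertex w)) :
  is_path (val x) (val y) (map val q) <-> is_path x y q.
Proof.
rewrite /is_path path_map last_map -map_cons (map_inj_uniq val_inj).
by split=> -[pq lq Uq]; split=> //; [apply: val_inj | rewrite lq].
Qed.

Lemma pendent_path_lift (G : sgraph) (w : G) (x y : del_vertex w)
    (p : seq G) :
  pendent w -> is_path (val x) (val y) p ->
  exists2 q, is_path x y q & p = map val q.
Proof.
move=> dw pP; have np := pendent_notin_path dw (valP x) (valP y) pP.
have [q pE] : exists q : seq (del_vertex w), p = map val q.
  elim: p np {pP} => [|z p IH]; first by exists [::].
  rewrite inE negb_or eq_sym => /andP[zw /IH[q ->]].
  by exists (Sub z zw :: q).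
by exists q => //; apply/is_path_del_vertex; rewrite -pE.
Qed.

(** Minimality carries over because every competing path of [del_vertex w] is also a path of [G]. *)
Lemma pendent_geodesic_lift (G : sgraph) (w : G) (x y : del_vertex w)
    (p : seq G) :
  pendent w -> geodesic (val x) (val y) p ->
  exists2 q, geodesic x y q & p = map val q.
Proof.
move=> dw [pP pmin]; have [q qP pE] := pendent_path_lift dw pP.
exists q => //; split=> // s /is_path_del_vertex/pmin.
by rewrite pE !size_map.
Qed.

(** The restriction of [c]: edges of [del_vertex w] are sets over a subtype and must be pushed
    forward to [G] first. *)
Definition del_vertex_colouring (G : sgraph) (w : G) (c : colouring G) :
  colouring (del_vertex w) := fun e => c [set val z | z in e].

Lemma rainbow_del_vertex (G : sgraph) (w : G) (c : colouring G)
    (x : del_vertex w) (q : seq (del_vertex w)) :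
  rainbow c (val x) (map val q) -> rainbow (@del_vertex_colouring G w c) x q.
Proof.
rewrite /rainbow; suff -> : pairmap (fun u v => c [set u; v]) (val x) (map val q) =
  pairmap (fun u v => @del_vertex_colouring G w c [set u; v]) x q by [].
elim: q x => //= z q IH x; congr (_ :: _) => //.
by rewrite /del_vertex_colouring imsetU1 imset_set1.
Qed.

Lemma num_colours_del_vertex (G : sgraph) (w : G) (c : colouring G) :
  num_colours (@del_vertex_colouring G w c) <= num_colours c.
Proof.
apply: uniq_leq_size; first exact: undup_uniq.
move=> k; rewrite !mem_undup => /imageP[e /edgesP[u [v [auv ->]]] ->].
rewrite /del_vertex_colouring imsetU1 imset_set1; apply: image_f.
exact: adj_edge.
Qed.

Lemma pendent_rc (G : sgraph) (w : G) : connected G -> pendent w ->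
  rc (del_vertex w) <= rc G.
Proof.
move=> cG dw; have [c cP <-] := rc_attained cG.
apply: leq_trans (num_colours_del_vertex w c); apply: rc_le => x y.
have [p /(pendent_path_lift dw)[q qP ->]] := cP (val x) (val y).
by move/rainbow_del_vertex; exists q.
Qed.

Lemma pendent_src (G : sgraph) (w : G) : connected G -> pendent w ->
  src (del_vertex w) <= src G.
Proof.
move=> cG dw; have [c cP <-] := src_attained cG.
apply: leq_trans (num_colours_del_vertex w c); apply: src_le => x y.
have [p /(pendent_geodesic_lift dw)[q qP ->]] := cP (val x) (val y).
by move/rainbow_del_vertex; exists q.
Qed.

(** * Complete graphs and two colours *)

Lemma diam_gt0 (G : sgraph) : connected G -> 1 < #|G| -> 0 < diam G.
Proof.
move=> cG /card_gt1P[x [y [_ _ neq]]]; apply: leq_trans (dist_le_diam x y).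
by rewrite lt0n; apply: contra_neq neq; apply: dist_eq0.
Qed.

Lemma diam_le1_complete (G : sgraph) : connected G -> diam G <= 1 -> complete G.
Proof.
by move=> cG d1 x y; apply: dist_le1 => //; apply: leq_trans (dist_le_diam x y) d1.
Qed.

Lemma geodesic_xx (G : sgraph) (x : G) : geodesic x x [::].
Proof. by []. Qed.

Lemma geodesic_adj (G : sgraph) (x y : G) : adj x y -> geodesic x y [:: y].
Proof.
move=> axy; have neq : x != y.
  by apply: contraTneq axy => ->; rewrite adj_irrefl.
split; first by split; rewrite //= ?axy ?inE ?neq.
by case=> // -[_ /= xy _]; rewrite xy eqxx in neq.
Qed.

Lemma complete_srcl_le1 (G : sgraph) : connected G -> complete G ->
  srcl G <= 1.
Proof.
move=> cG compG; apply: srcl_le => L rL.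
(* Any list colouring will do, since every geodesic has at most one edge; hence the empty set for
   [T]. *)
have [|c cL _] := list_colouring_inj rL isT (sub0set _); first by rewrite cards0.
exists c => // x y; have [->|/compG/geodesic_adj] := eqVneq x y.
  by exists [::]; first exact: geodesic_xx.
by exists [:: y].
Qed.

(** Distinct non-adjacent vertices are at distance at least two, while a rainbow path in two colours
    has at most two edges, hence is a geodesic. *)
Lemma rainbow_connected_two_colours (G : sgraph) (c : colouring G) :
  num_colours c <= 2 -> rainbow_connected c -> strongly_rainbow_connected c.
Proof.
move=> c2 cP x y; have [axy|naxy] := boolP (adj x y).
  by exists [:: y]; first exact: geodesic_adj.
have [xy|xy] := eqVneq x y.
  by rewrite xy; exists [::]; first exact: geodesic_xx.
have [p pP rp] := cP x y; exists p => //; split=> // q [pq lq _].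
apply: leq_trans (leq_trans (rainbow_size pP rp) c2) _.
case: q pq lq => [_ /= xy'|z [|//] /=]; first by rewrite xy' eqxx in xy.
by rewrite andbT => axz zy; rewrite -zy axz in naxy.
Qed.

(** * Trees, and graphs with an edge that is not a bridge *)

(** A path from [a] to [b] avoiding the edge [ab] would close up to a cycle. *)
Lemma tree_bridges (G : sgraph) : tree G -> bridges G = edges G.
Proof.
case=> cG acyc; apply/eqP; rewrite eqEsubset; apply/andP; split.
  by apply/subsetP=> e /setIdP[].
apply/subsetP=> e /edgesP[a [b [aab ->]]]; apply/(bridgeP cG aab).
case/connectP=> p /shortenP[q pq Uq _] bE.
have pGq : path (@adj G) a q by apply: sub_path pq => u v /andP[].
apply: (acyc (a :: q)); last by rewrite /ucycle Uq andbT /= rcons_path pGq -bE adj_sym.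
(* The cycle has at least three vertices: [q] is not empty as [a] and [b] differ, and not the single
   step to [b], which was deleted. *)
case: q pq bE {Uq pGq} => [|z [|//]] /=.
  by move=> _ ba; rewrite ba adj_irrefl in aab.
by rewrite andbT => /andP[_ +] bz; rewrite bz eqxx.
Qed.

(** Let [a], [b] be the first two vertices of a cycle; the rest of the cycle leads from [b] back to
    [a]. *)
Lemma not_tree_nonbridge (G : sgraph) : connected G -> ~ tree G ->
  exists a b : G, adj a b /\ connect (@adj (del_edge [set a; b])) a b.
Proof.
move=> cG ntree.
have [s s3 /andP[cs Us]] : exists2 s : seq G, 2 < size s & ucycle (@adj G) s.
  apply: contra_notP ntree => ns; split=> // s s3 cs; apply: ns; by exists s.
case: s s3 cs Us => [|a [|b [|z s]]] // _ /= /and3P[aab abz ps].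
rewrite !inE !negb_or => /and4P[/and3P[_ az ns] /andP[bz nbs] _ _].
exists a, b; split=> //; rewrite (@adj_connect_sym (del_edge [set a; b])).
apply/connectP; exists (z :: rcons s a); last by rewrite /= last_rcons.
apply: path_del_edge; first by rewrite /= abz.
(* The edge [ab] is not the first edge [bz], since [a] differs from [z], nor a later one, since [b]
   does not recur. *)
rewrite inE negb_or; apply/andP; split.
  apply: contraTneq az => /set2_eq[[ab _]|[-> _]]; last by rewrite eqxx.
  by rewrite ab adj_irrefl in aab.
apply/negP=> /path_edges_vertex/(_ (set22 a b)).
rewrite !inE mem_rcons inE (negPf bz) (negPf nbs) /= orbF => /eqP ba.
by rewrite ba adj_irrefl in aab.
Qed.

Lemma not_tree_separated_edges (G : sgraph) : connected G -> ~ tree G ->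
  exists e f : {set G}, [/\ e \in edges G, f \in edges G, e != f &
    forall (x y : G) p, geodesic x y p ->
      ~ (e \in path_edges x p /\ f \in path_edges x p)].
Proof.
move=> cG /(not_tree_nonbridge cG)[a [b [aab /connectP[p pp bE]]]].
have neq : a != b by apply: contraTneq aab => ->; rewrite adj_irrefl.
have [||c [d [/andP[acd ne] Pc nPd]]] :=
  path_exit (P := fun z => dist a z < dist b z) pp.
- rewrite dist_xx // lt0n; apply: contra_neq neq => /(dist_eq0 cG)/esym.
  exact.
- by rewrite -bE dist_xx // ltn0.
exists [set a; b], [set c; d]; split; rewrite ?adj_edge // 1?eq_sym //.
move=> x y q gq [abq cdq]; case/negP: nPd.
by apply: (geodesic_edges_same_side cG gq abq cdq) Pc; rewrite eq_sym.
Qed.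

(* Colour greedily all edges but [f]; the colour of [f] then only has to avoid
   those of the edges other than [e]. *)
Lemma not_tree_srcl_lt (G : sgraph) : connected G -> ~ tree G ->
  srcl G < #|edges G|.
Proof.
move=> cG /(not_tree_separated_edges cG)[e [f [eE fE nef sep]]].
have cardT : #|edges G| = #|edges G :\ f|.+1 by rewrite (cardsD1 f) fE.
have cardT' : #|edges G :\ f| = #|edges G :\ f :\ e|.+1.
  by rewrite (cardsD1 e) !inE nef eE.
rewrite cardT ltnS; apply: srcl_le => L rL.
have [|c cL cI] := list_colouring_inj rL _ (subD1set _ f) (leqnn _).
  by rewrite cardT'.
pose used := [seq c g | g in edges G :\ f :\ e].
have [||k Lk nk] := @card_le_avoid #|edges G :\ f| (L f) used.
- exact: rL.
- by rewrite size_image cardT'.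
pose d g := if g == f then k else c g.
(* The only collision left open is between [f] and [e], which never lie on a common geodesic. *)
have dI g h : g \in edges G -> h \in edges G -> h != f -> d g = d h ->
    g = h \/ (g = f /\ h = e).
  move=> gE hE nhf; rewrite /d (negPf nhf); case: eqP => [->|/eqP ngf] kE.
    right; split=> //; apply: contraNeq nk => nhe; rewrite kE.
    by apply: image_f; rewrite !inE nhe nhf.
  by left; apply: cI; rewrite ?inE ?ngf ?nhf.
exists d => [g gE|x y].
  by rewrite /d; case: eqP => [->//|_]; apply: cL.
have [p gp _] := dist_attained x y cG; exists p => //.
have nosep := sep _ _ _ gp; have [pP _] := gp; have [pp _ _] := pP.
apply: (rainbow_inj_in pP) => g h gp' hp.
have [gE hE] := (path_edges_sub pp gp', path_edges_sub pp hp).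
have [hf|nhf] := eqVneq h f; last first.
  by case/(dI _ _ gE hE nhf) => // -[gf he]; case: nosep; rewrite -gf -he.
have [gf|ngf] := eqVneq g f; first by rewrite hf gf.
by move/esym/(dI _ _ hE gE ngf) => [// |[_ ge]]; case: nosep; rewrite -ge -hf.
Qed.

Theorem theorem2p1 (G : sgraph) (nontrivialG : 1 < #|G|)
    (connG : connected G) :
  (* (a) *)
  ((diam G <= rc G /\ rc G <= rcl G /\ rcl G <= #|G| - 1) /\
   (diam G <= rc G /\ rc G <= src G /\ src G <= srcl G /\
    srcl G <= #|edges G|)) /\
  (* (b) *)
  (forall p : nat, #|bridges G| = p -> p <= rc G) /\
  (* (c) *)
  (forall (v : G) (q : nat), cut_vertex v ->
     components (del_vertex v) = q -> 2 <= q -> q <= src G) /\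
  (* (d) *)
  (forall w : G, 3 <= #|G| -> pendent w ->
     rc (del_vertex w) <= rc G /\ src (del_vertex w) <= src G) /\
  (* (e) *)
  [<-> complete G; diam G = 1; rc G = 1; src G = 1; rcl G = 1; srcl G = 1] /\
  (* (f) *)
  ((rc G = 2 <-> src G = 2) /\
   (srcl G = 2 -> rcl G = 2) /\
   (rcl G = 2 -> rc G = 2 /\ src G = 2)) /\
  (* (g) *)
  [<-> tree G; rc G = #|edges G|; src G = #|edges G|; rcl G = #|edges G|;
       srcl G = #|edges G|].
Proof.
have E0 := edges_gt0 connG nontrivialG.
have d0 := diam_gt0 connG nontrivialG.
have d_rc := diam_le_rc connG.
have rc_src := rc_le_src connG.
have rc_rcl := rc_le_rcl connG E0.
have src_srcl := src_le_srcl connG E0.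
have rcl_srcl := rcl_le_srcl connG E0.
have srcl_E := srcl_le_edges connG E0.
(* This bounds the top of both chains by their bottom: as soon as one of the invariants is at most
   1, all are. Parts (e) and (f) then become linear arithmetic, apart from completeness and
   [rc2_src]. *)
have d1_srcl : diam G <= 1 -> srcl G <= 1.
  by move=> /(diam_le1_complete connG)/(complete_srcl_le1 connG).
have rc2_src : rc G = 2 -> src G <= 2.
  move=> rc2; have [c cP cE] := rc_attained connG; rewrite -rc2 -cE.
  by apply/src_le/rainbow_connected_two_colours; rewrite // cE rc2.
have E_tree : srcl G = #|edges G| -> tree G.
  by move=> sE; apply: contrapT => /(not_tree_srcl_lt connG); rewrite sE ltnn.
(* In a tree all edges are bridges, which pushes the bottom of the chain up to the number of
   edges. *)
have E_rc : srcl G = #|edges G| -> rc G = #|edges G|.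
  move=> /E_tree/tree_bridges TB; have := bridges_le_rc connG.
  by rewrite TB; lia.
split; first by do !split=> //; apply: rcl_le_order.
split; first by move=> p <-; apply: bridges_le_rc.
split; first by move=> v q _ <- _; apply: components_le_src.
split; first by move=> w _ dw; split; [apply: pendent_rc | apply: pendent_src].
split.
  tfae; try lia.
  - by move=> /(complete_srcl_le1 connG); lia.
  - by move=> s1; apply: diam_le1_complete => //; lia.
split; first by do ![split]; lia.
tfae => //; try lia.
by move=> /tree_bridges TB; have := bridges_le_rc connG; rewrite TB; lia.
Qed.
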